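(* Let $m\ge2$ and let $X$ be an $L_m$-conditional solution of $$\mathrm dX_t=b(t,X_t)\,\mathrm dt+\sigma(t,X_t)\,\mathrm dB_t+(f,f')(t,X_t)\,\mathrm d\mathbf Z_t$$ on a stochastic basis $(\Omega,\mathcal A,(\mathcal F_t),\mathbb P)$ with Brownian motion $B$. Let $(\mathcal G_t)$ be a filtration with $\mathcal F_t\subseteq\mathcal G_t$ for all $t$ such that $(\mathcal F_t)$ is immersed in $(\mathcal G_t)$, i.e. every $(\mathcal F_t)$-martingale is a $(\mathcal G_t)$-martingale. Then $B$ is a $(\mathcal G_t)$-Brownian motion, and $X$ is an $L_m$-conditional solution of the same equation on $(\Omega,\mathcal A,(\mathcal G_t),\mathbb P)$ with the same Brownian motion and the same rough path, and the two moduli of the solution notion may be taken to be the same functions on $(\mathcal G_t)$ as on $(\mathcal F_t)$. The same holds with ''$L_m$-conditional solution'' replaced by ''$L_{m,\infty}$-solution''.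
   Context: **Setting.** $T>0$, $n,d,e\ge1$, $\gamma\in(\tfrac13,\tfrac12)$, $D\subseteq\mathbb R^n$ closed. $\delta Y_{s,t}:=Y_t-Y_s$. Driver: $\mathbf Z=(Z,\mathbb Z)$ is a fixed deterministic $\gamma$-rough path: $Z:[0,T]\to\mathbb R^e$, $\mathbb Z_{s,t}\in\mathbb R^{e\times e}$, $\mathbb Z_{s,t}-\mathbb Z_{s,u}-\mathbb Z_{u,t}=\delta Z_{s,u}\otimes\delta Z_{u,t}$, $\sup_{s<t}|\delta Z_{s,t}|/|t-s|^\gamma+\sup_{s<t}|\mathbb Z_{s,t}|/|t-s|^{2\gamma}<\infty$, with Lipschitz bracket: $[\mathbf Z]_{s,t}:=\delta Z_{s,t}\otimes\delta Z_{s,t}-2\operatorname{Sym}\mathbb Z_{s,t}$ satisfies $\sup_{s<t}|[\mathbf Z]_{s,t}|/|t-s|<\infty$. Coefficients: $b:[0,T]\times\mathbb R^n\to\mathbb R^n$, $\sigma:[0,T]\times\mathbb R^n\to\mathbb R^{n\times d}$, and a deterministic controlled vector field $(f,f')$, $f=(f^\kappa)_{\kappa\le e}$, $f'=(f'^{\kappa\lambda})_{\kappa,\lambda\le e}$ with $f^\kappa_t,f'^{\kappa\lambda}_t:\mathbb R^n\to\mathbb R^n$, $f_t\in C^1$ in $x$, such that for some $\beta,\beta'>0$, $C<\infty$ and all $s\le t$, $x$: $|f_t(x)-f_s(x)-f'_s(x)\delta Z_{s,t}|\le C(1+|x|)|t-s|^{\beta+\beta'}$, $|f'_t(x)-f'_s(x)|\le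 C(1+|x|)|t-s|^{\beta'}$, where $(f'_s\delta Z_{s,t})^\lambda=\sum_\kappa f_s'^{\kappa\lambda}\delta Z^\kappa_{s,t}$. $(Df\,f+f')^{\kappa\lambda}:=Df^\lambda f^\kappa+f'^{\kappa\lambda}$. Standing continuity: $b,\sigma,f,Df\,f+f'$ are continuous in $(t,x)$. Filtrations here are $\mathbb P$-complete; right-continuity is not assumed. **Solutions.** On a stochastic basis with an $(\mathcal F_t)$-Brownian motion $B$ in $\mathbb R^d$, $B_0=0$, let $X$ be continuous, $(\mathcal F_t)$-adapted and $D$-valued, and let $$J_{s,t}:=\delta X_{s,t}-\int_s^tb_r(X_r)\mathrm dr-\int_s^t\sigma_r(X_r)\mathrm dB_r-\sum_\kappa f^\kappa_s(X_s)\delta Z^\kappa_{s,t}-\sum_{\kappa,\lambda}(Df_s^\lambda f_s^\kappa+f_s'^{\kappa\lambda})(X_s)\mathbb Z^{\kappa\lambda}_{s,t}.$$ For $m\ge2$, $X$ is an *$L_m$-conditional solution* if $J_{s,t}\in L_m(\mathbb P)$ for all $s\le t$ and, uniformly in $s\le t$ as $|t-s|\to0$, $$\|\mathbb E[J_{s,t}\mid\mathcal F_s]\|_{L_m(\mathbb P)}=o(|t-s|),\qquad \big\|\mathbb E[|J_{s,t}|^m\mid\mathcal F_s]^{1/m}\big\|_{L_m(\mathbb P)}=\|J_{s,t}\|_{L_m(\mathbb P)}=o(|t-s|^{1/2}).$$ It is an *$L_{m,\infty}$-solution* if the two outer norms $L_m(\mathbb P)$ are replaced by $L_\infty(\Omega)$,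 i.e. $\|\mathbb E[J_{s,t}\mid\mathcal F_s]\|_{L_\infty}=o(|t-s|)$ and $\|\mathbb E[|J_{s,t}|^m\mid\mathcal F_s]^{1/m}\|_{L_\infty}=o(|t-s|^{1/2})$ uniformly in $s\le t$ (with $J_{s,t}\in L_m(\mathbb P)$ still required). The *moduli* are functions $\omega,\omega'$ on $[0,T]$ (values in $[0,\infty]$) with $\omega(h)/h\to0$, $\omega'(h)/h^{1/2}\to0$ as $h\downarrow0$, bounding the two left-hand sides by $\omega(|t-s|)$, $\omega'(|t-s|)$ at every pair $s\le t$. *)

(* Defs.v *)
From HB Require Import structures.
From mathcomp Require Export all_boot all_order all_algebra.
From mathcomp Require Export all_classical all_reals all_analysis.

Set Implicit Arguments.
Unset Strict Implicit.
Unset Printing Implicit Defensive.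

Export Order.TTheory GRing.Theory Num.Theory.
Export numFieldNormedType.Exports.

Local Open Scope classical_set_scope.
Local Open Scope ring_scope.

(* The norm that the library puts on matrices is the sup norm, whereas the
   moduli below refer to the Euclidean (Frobenius) one. *)
Definition enorm {R : realType} {p q : nat} (A : 'M[R]_(p, q)) : R :=
  Num.sqrt (\sum_i \sum_j A i j ^+ 2).

Section Equation.
Context {R : realType} {n d e : nat}.

(* [vf t k] and [vf' t k l] are the components f^k_t and f'^{kl}_t of the
   controlled vector field, [rZ] and [rZZ s t] the two levels of the driver. *)
Record rough_sde := RoughSDE {
  drift : R -> 'cV[R]_n -> 'cV[R]_n;
  diffusion : R -> 'cV[R]_n -> 'M[R]_(n, d);
  vf : R -> 'I_e -> 'cV[R]_n -> 'cV[R]_n;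
  vf' : R -> 'I_e -> 'I_e -> 'cV[R]_n -> 'cV[R]_n;
  rZ : R -> 'cV[R]_e;
  rZZ : R -> R -> 'M[R]_e }.

Variables (T gamma : R) (S : rough_sde).

Definition incr {V : zmodType} (Y : R -> V) (s t : R) : V := Y t - Y s.

Definition tensor (x y : 'cV[R]_e) : 'M[R]_e := x *m y^T.

Definition msym (A : 'M[R]_e) : 'M[R]_e := 2^-1 *: (A + A^T).

Definition bracket (s t : R) : 'M[R]_e :=
  tensor (incr (rZ S) s t) (incr (rZ S) s t) - 2 *: msym (rZZ S s t).

Definition rough_path : Prop :=
  (forall s u t : R, 0 <= s -> s <= u -> u <= t -> t <= T ->
     rZZ S s t - rZZ S s u - rZZ S u t
     = tensor (incr (rZ S) s u) (incr (rZ S) u t)) /\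
  (exists C : R, forall s t : R, 0 <= s -> s < t -> t <= T ->
     enorm (incr (rZ S) s t) / (t - s) `^ gamma <= C /\
     enorm (rZZ S s t) / (t - s) `^ (2 * gamma) <= C).

Definition lipschitz_bracket : Prop :=
  exists C : R, forall s t : R, 0 <= s -> s < t -> t <= T ->
    enorm (bracket s t) / (t - s) <= C.

(* (Df f + f')^{kl} = Df^l f^k + f'^{kl} *)
Definition Dff (t : R) (k l : 'I_e) (x : 'cV[R]_n) : 'cV[R]_n :=
  'd (vf S t l) x (vf S t k x) + vf' S t k l x.

Definition C1 (g : 'cV[R]_n -> 'cV[R]_n) : Prop :=
  (forall x, differentiable g x) /\
  (forall v, continuous (fun x => 'd g x v)).

Definition controlled_vector_field : Prop :=
  (forall (t : R) k, 0 <= t -> t <= T -> C1 (vf S t k)) /\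
  exists beta beta' C : R, [/\ 0 < beta, 0 < beta',
    (forall (s t : R) x l, 0 <= s -> s <= t -> t <= T ->
       enorm (vf S t l x - vf S s l x
              - \sum_k incr (rZ S) s t k 0 *: vf' S s k l x)
       <= C * (1 + enorm x) * (t - s) `^ (beta + beta')) &
    (forall (s t : R) x k l, 0 <= s -> s <= t -> t <= T ->
       enorm (vf' S t k l x - vf' S s k l x)
       <= C * (1 + enorm x) * (t - s) `^ beta')].

Definition jointly_continuous {V : topologicalType}
    (g : R -> 'cV[R]_n -> V) : Prop :=
  {within [set p : R * 'cV[R]_n | 0 <= p.1 <= T],
    continuous (fun p => g p.1 p.2)}.

Definition continuous_coefficients : Prop :=
  [/\ jointly_continuous (drift S), jointly_continuous (diffusion S),
      (forall k, jointly_continuous (fun t => vf S t k)) &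
      (forall k l, jointly_continuous (fun t => Dff t k l))].

Definition standing_assumptions : Prop :=
  [/\ rough_path, lipschitz_bracket, controlled_vector_field &
      continuous_coefficients].

End Equation.
Arguments rough_sde : clear implicits.

Section Basis.
Context {R : realType} {dO : measure_display} {Omega : measurableType dO}.
Variables (T : R) (P : probability Omega R).

(* Only the indices in [0, T] matter. Completeness is with respect to all
   P-null sets, so that the underlying space is complete as well. *)
Definition filtration (F : R -> set (set Omega)) : Prop :=
  [/\ (forall t : R, 0 <= t <= T -> sigma_algebra setT (F t)),
      (forall t : R, 0 <= t <= T -> F t `<=` measurable),
      (forall s t : R, 0 <= s -> s <= t -> t <= T -> F s `<=` F t) &
      (forall t : R, 0 <= t <= T -> forall N, P.-negligible N -> F t N)].

Definition measurable_wrt (F : set (set Omega)) (Y : Omega -> R) : Prop :=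
  forall C : set R, measurable C -> F (Y @^-1` C).

Definition mx_measurable_wrt (F : set (set Omega)) {p q : nat}
    (Y : Omega -> 'M[R]_(p, q)) : Prop :=
  forall i j, measurable_wrt F (fun w => Y w i j).

Definition adapted (F : R -> set (set Omega)) {p q : nat}
    (X : R -> Omega -> 'M[R]_(p, q)) : Prop :=
  forall t : R, 0 <= t <= T -> mx_measurable_wrt (F t) (X t).

Definition continuous_paths {p q : nat}
    (X : R -> Omega -> 'M[R]_(p, q)) : Prop :=
  forall w, {within `[0, T], continuous (fun t => X t w)}.

Definition is_cexp (F : set (set Omega)) (X Y : Omega -> R) : Prop :=
  [/\ measurable_wrt F Y, P.-integrable setT (EFin \o Y) &
      forall A, F A ->
        (\int[P]_(w in A) (Y w)%:E = \int[P]_(w in A) (X w)%:E)%E].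

(* A chosen version of E[X | F]; meaningful for integrable X only. *)
Definition cexp (F : set (set Omega)) (X : Omega -> R) : Omega -> R :=
  xget (cst 0) [set Y | is_cexp F X Y].

Definition mx_cexp (F : set (set Omega)) {p q : nat}
    (X : Omega -> 'M[R]_(p, q)) : Omega -> 'M[R]_(p, q) :=
  fun w => \matrix_(i, j) cexp F (fun w' => X w' i j) w.

Definition martingale (F : R -> set (set Omega)) (M : R -> Omega -> R) : Prop :=
  [/\ (forall t : R, 0 <= t <= T -> measurable_wrt (F t) (M t)),
      (forall t : R, 0 <= t <= T -> P.-integrable setT (EFin \o M t)) &
      (forall s t : R, 0 <= s -> s <= t -> t <= T -> is_cexp (F s) (M t) (M s))].

Definition immersed (F G : R -> set (set Omega)) : Prop :=
  forall M, martingale F M -> martingale G M.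

Definition brownian_motion (F : R -> set (set Omega)) {d : nat}
    (B : R -> Omega -> 'cV[R]_d) : Prop :=
  [/\ (forall w, B 0 w = 0), continuous_paths B, adapted F B &
      forall s t : R, 0 <= s -> s < t -> t <= T ->
        (* the increment is independent of F_s ... *)
        (forall A (C : set (d.-tuple R)),
           F s A -> measurable C ->
           let E := [set w | C [tuple B t w j 0 - B s w j 0 | j < d]] in
           P (A `&` E) = (P A * P E)%E) /\
        (* ... and has law N(0, (t - s) I_d) *)
        (forall C : 'I_d -> set R, (forall j, measurable (C j)) ->
           P [set w | forall j, C j (B t w j 0 - B s w j 0)]
           = (\prod_(j < d) normal_prob 0 (Num.sqrt (t - s)) (C j))%E)].

Definition cvg_in_probability0 (Y : nat -> Omega -> \bar R) : Prop :=
  forall eps : R, 0 < eps ->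
    (fun k => P [set w | (eps%:E < `|Y k w|)%E]) @ \oo --> 0%E.

Section Ito.
Context {n d : nat}.

(* H_t = \sum_(k < sp_size) sp_coef k 1_(sp_time k < t <= sp_time k.+1) *)
Record simple_process := SimpleProcess {
  sp_size : nat;
  sp_time : nat -> R;
  sp_coef : nat -> Omega -> 'M[R]_(n, d) }.

Definition simple_adapted (F : R -> set (set Omega)) (H : simple_process) :=
  [/\ (forall k, (k <= sp_size H)%N -> 0 <= sp_time H k <= T),
      (forall k, (k < sp_size H)%N -> sp_time H k <= sp_time H k.+1),
      (forall k, (k < sp_size H)%N ->
         mx_measurable_wrt (F (sp_time H k)) (sp_coef H k)) &
      (exists C : R, forall k w, (k < sp_size H)%N ->
         enorm (sp_coef H k w) <= C)].

Definition simple_value (H : simple_process) (t : R) (w : Omega) :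
    'M[R]_(n, d) :=
  \sum_(k < sp_size H)
    (if sp_time H k < t <= sp_time H k.+1 then sp_coef H k w else 0).

Definition simple_integral (B : R -> Omega -> 'cV[R]_d) (H : simple_process)
    (t : R) (w : Omega) : 'cV[R]_n :=
  \sum_(k < sp_size H) sp_coef H k w *m
    (B (Num.min (sp_time H k.+1) t) w - B (Num.min (sp_time H k) t) w).

(* I is (a version of) the Ito integral process \int_0^. H dB: the continuous
   adapted process obtained as limit in probability of the integrals of bounded
   simple processes approximating H in the sense that
   \int_0^T |H^k_r - H_r|^2 dr --> 0 in probability. For a Brownian motion B and
   a continuous adapted H it exists and is unique up to indistinguishability, so
   it does not matter which version is used. *)
Definition ito_integral (F : R -> set (set Omega)) (B : R -> Omega -> 'cV[R]_d)
    (H : R -> Omega -> 'M[R]_(n, d)) (I : R -> Omega -> 'cV[R]_n) : Prop :=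
  [/\ continuous_paths I, adapted F I &
    exists Hk : nat -> simple_process,
      [/\ (forall k, simple_adapted F (Hk k)),
          cvg_in_probability0 (fun k w =>
            (\int[lebesgue_measure]_(r in `[0%R, T])
              ((enorm (simple_value (Hk k) r w - H r w)) ^+ 2)%:E)%E) &
          (forall t : R, 0 <= t <= T ->
            cvg_in_probability0 (fun k w =>
              (enorm (simple_integral B (Hk k) t w - I t w))%:E))]].

End Ito.
End Basis.

Section Solution.
Context {R : realType} {dO : measure_display} {Omega : measurableType dO}.
Context {n d e : nat}.
Variables (T : R) (P : probability Omega R) (D : set 'cV[R]_n).
Variable S : rough_sde R n d e.
Variables (F : R -> set (set Omega)) (B : R -> Omega -> 'cV[R]_d).

(* J_{s,t}, where I stands for the Ito integral process of sigma(X) *)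
Definition remainder (X I : R -> Omega -> 'cV[R]_n) (s t : R) (w : Omega) :
    'cV[R]_n :=
  (X t w - X s w)
  - (\col_i \int[lebesgue_measure]_(r in `[s, t]) (drift S r (X r w) i 0))
  - (I t w - I s w)
  - \sum_k incr (rZ S) s t k 0 *: vf S s k (X s w)
  - \sum_k \sum_l rZZ S s t k l *: Dff S s k l (X s w).

(* || E[J_{s,t} | F_s] ||_{L_q} *)
Definition cond_bias (q : \bar R) (J : R -> R -> Omega -> 'cV[R]_n) (s t : R) :
    \bar R :=
  Lnorm P q (fun w => (enorm (mx_cexp P (F s) (J s t) w))%:E).

(* || E[|J_{s,t}|^m | F_s]^(1/m) ||_{L_q} *)
Definition cond_size (m : R) (q : \bar R) (J : R -> R -> Omega -> 'cV[R]_n)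
    (s t : R) : \bar R :=
  Lnorm P q (fun w =>
    ((cexp P (F s) (fun w' => enorm (J s t w') `^ m) w) `^ m^-1)%:E).

Definition in_Lm (m : R) (J : R -> R -> Omega -> 'cV[R]_n) : Prop :=
  forall s t : R, 0 <= s -> s <= t -> t <= T ->
  forall i, (fun w => J s t w i 0) \in Lfun P m%:E.

(* N_{s,t} = o(|t - s|^a) uniformly in s <= t *)
Definition uniform_o (a : R) (N : R -> R -> \bar R) : Prop :=
  forall eps : R, 0 < eps -> exists2 delta : R, 0 < delta &
    forall s t : R, 0 <= s -> s <= t -> t <= T -> t - s <= delta ->
      (N s t <= (eps * (t - s) `^ a)%:E)%E.

Definition modulus (a : R) (omega : R -> \bar R) : Prop :=
  (forall h : R, 0 <= h <= T -> (0 <= omega h)%E) /\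
  (fun h : R => (omega h * ((h `^ a)^-1)%:E)%E) @ 0^'+ --> 0%E.

Definition bounded_by (omega : R -> \bar R) (N : R -> R -> \bar R) : Prop :=
  forall s t : R, 0 <= s -> s <= t -> t <= T -> (N s t <= omega (t - s)%R)%E.

Definition state_process (X : R -> Omega -> 'cV[R]_n) : Prop :=
  [/\ continuous_paths T X, adapted T F X &
      forall (t : R) w, 0 <= t <= T -> D (X t w)].

(* The outer exponent q is m for L_m-conditional solutions and +oo for
   L_{m,oo}-solutions. *)
Definition solution (m : R) (q : \bar R) (X : R -> Omega -> 'cV[R]_n) : Prop :=
  state_process X /\
  exists I, [/\
    ito_integral T P F B (fun r w => diffusion S r (X r w)) I,
    in_Lm m (remainder X I),
    uniform_o 1 (cond_bias q (remainder X I)) &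
    uniform_o 2^-1 (cond_size m q (remainder X I))].

Definition solution_with_moduli (m : R) (q : \bar R)
    (omega omega' : R -> \bar R) (X : R -> Omega -> 'cV[R]_n) : Prop :=
  [/\ state_process X, modulus 1 omega, modulus 2^-1 omega' &
  exists I, [/\
    ito_integral T P F B (fun r w => diffusion S r (X r w)) I,
    in_Lm m (remainder X I),
    bounded_by omega (cond_bias q (remainder X I)) &
    bounded_by omega' (cond_size m q (remainder X I))]].

Definition Lm_solution (m : R) := solution m m%:E.
Definition Lm_solution_with_moduli (m : R) := solution_with_moduli m m%:E.
Definition Lmoo_solution (m : R) := solution m +oo%E.
Definition Lmoo_solution_with_moduli (m : R) := solution_with_moduli m +oo%E.

End Solution.

(* Main.v *)
From HB Require Import structures.
From mathcomp Require Import lra.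
Require Import Defs.
From mathcomp Require Import measurable_realfun ess_sup_inf hoelder.

(* Let [Y] be integrable and [F t]-measurable.  The process equal to
   [E[Y | F u]] for [u < t] and to [Y] for [u >= t] is an [F]-martingale, hence
   a [G]-martingale by immersion, so [E[Y | F s]] is also a version of
   [E[Y | G s]].  For the indicator of an event of [B t - B s], whose
   [F s]-conditional expectation is constant, this is independence from [G s].
   The remainder [J s t] is [F t]-measurable, so its conditional expectation
   and that of its [m]-th power norm given [F s] and given [G s] agree almost
   surely, and so do their outer norms.  The Ito integral does not change,
   because [F]-adapted simple processes are [G]-adapted. *)

Set Implicit Arguments.
Unset Strict Implicit.
Unset Printing Implicit Defensive.

Local Open Scope classical_set_scope.
Local Open Scope ring_scope.

(** * Conditional expectation given a sub-sigma-algebra *)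

Section ConditionalExpectation.
Context {dO : measure_display} {Omega : measurableType dO} {R : realType}.
Variable P : probability Omega R.
Implicit Types (F G : set (set Omega)) (X Y : Omega -> R).

Lemma measurable_wrtP F Y : sigma_algebra setT F ->
  measurable_wrt F Y <-> measurable_fun [set: g_sigma_algebraType F] Y.
Proof.
move=> sF; split => [mY _ C mC|mY C mC].
  by rewrite setTI measurable_g_measurableTypeE//; exact: mY.
by have := mY measurableT C mC; rewrite setTI measurable_g_measurableTypeE.
Qed.

Lemma sub_sigma_measurable_wrt F Y :
  F `<=` measurable -> measurable_wrt F Y -> measurable_fun [set: Omega] Y.
Proof. by move=> FO mY _ C mC; rewrite setTI; exact/FO/mY. Qed.

Lemma sub_sigma_algebra_measurable_id F : sigma_algebra setT F ->
  F `<=` measurable ->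
  measurable_fun [set: Omega] (id : Omega -> g_sigma_algebraType F).
Proof.
move=> sF FO _ A; rewrite measurable_g_measurableTypeE// => FA.
by rewrite setTI; exact: FO.
Qed.

Section SubSigmaAlgebra.
Variables (F : set (set Omega)).
Hypotheses (sF : sigma_algebra setT F) (FO : F `<=` measurable).

(** The sub-sigma-algebra becomes a measurable type of its own, and [Q] below is the restriction of
    [P] to it, obtained as the image of [P] under the identity. Theorems about measures on a type
    then apply to [F]. *)
Let F' : measurableType _ := g_sigma_algebraType F.

Let idF : {mfun Omega >-> F'} := HB.pack (id : Omega -> F')
  (isMeasurableFun.Build _ _ _ _ _ (sub_sigma_algebra_measurable_id sF FO)).

Let Q : probability F' R := distribution P idF.

Let intQ (f : Omega -> R) A : measurable_wrt F f ->
  P.-integrable setT (EFin \o f) -> F A ->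
  (\int[Q]_(w in A) (f w)%:E = \int[P]_(w in A) (f w)%:E)%E.
Proof.
move=> /(measurable_wrtP _ sF) mf fi FA.
apply: (integral_pushforward (sub_sigma_algebra_measurable_id sF FO)).
- exact/measurable_EFinP.
- by apply: integrableS fi => //; exact: FO.
- by rewrite measurable_g_measurableTypeE.
Qed.

Let integrableQ (f : Omega -> R) : measurable_wrt F f ->
  P.-integrable setT (EFin \o f) -> Q.-integrable setT (EFin \o f : F' -> _).
Proof.
move=> /(measurable_wrtP _ sF) mf fi.
apply: (integrable_pushforward (sub_sigma_algebra_measurable_id sF FO)) => //.
exact/measurable_EFinP.
Qed.

(** Two versions have equal integrals over every event of [F], hence agree [Q]-almost everywhere. *)
Lemma is_cexp_ae_eq X Y Y' : is_cexp P F X Y -> is_cexp P F X Y' ->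
  ae_eq P setT Y Y'.
Proof.
move=> [mY iY YX] [mY' iY' Y'X].
have : ae_eq Q setT (EFin \o Y : F' -> _) (EFin \o Y').
  apply: integral_ae_eq => //; first exact: integrableQ.
    by apply/measurable_EFinP/measurable_wrtP.
  move=> E _; rewrite measurable_g_measurableTypeE// => FE.
  by rewrite !intQ// YX// Y'X.
move=> [N [mN QN YN]].
(* The exceptional set lies in [F], where [Q] and [P] coincide, so it is [P]-null as well. *)
exists N; split => //.
  by apply: FO; move: mN; rewrite measurable_g_measurableTypeE.
apply: subset_trans YN => w /= nY H; apply: nY => /H.
by move=> [].
Qed.

(* Radon-Nikodym on the measurable type carrying [F], for the images of [P] and
   of the charge with density [X] under the identity. *)
Lemma is_cexp_exists X : P.-integrable setT (EFin \o X) ->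
  exists Y, is_cexp P F X Y.
Proof.
move=> iX.
pose nu : {charge set F' -> \bar R} :=
  measure_function_pushforward__canonical__charge_Charge (induced_charge iX)
   (sub_sigma_algebra_measurable_id sF FO).
have nuQ : nu `<< Q.
  apply/null_content_dominatesP => A.
  rewrite measurable_g_measurableTypeE// => /FO mA QA.
  rewrite /nu/= /pushforward /induced_charge/=.
  apply: null_set_integral => //.
  exact: measurable_funTS (measurable_int _ iX).
(* The Radon-Nikodym derivative is finite everywhere, so [fine] loses nothing. *)
exists (fun w => fine (Radon_Nikodym nu Q w)).
have RN_fin w := @Radon_Nikodym_fin_num _ _ _ nu Q w nuQ.
have iRN : Q.-integrable setT (Radon_Nikodym nu Q).
  exact: Radon_Nikodym_integrable.
have RNE : EFin \o (fun w => fine (Radon_Nikodym nu Q w)) = Radon_Nikodym nu Q.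
  by apply/funext => w; rewrite /= fineK.
have mRN : measurable_fun [set: F'] (fun w => fine (Radon_Nikodym nu Q w)).
  by apply/measurable_EFinP; rewrite RNE; exact: (measurable_int _ iRN).
have mwRN : measurable_wrt F (fun w => fine (Radon_Nikodym nu Q w)).
  exact/measurable_wrtP.
have iRNP : P.-integrable setT (EFin \o fun w => fine (Radon_Nikodym nu Q w)).
  apply/integrableP; split.
    by apply/measurable_EFinP; exact: (sub_sigma_measurable_wrt FO).
  move/integrableP : iRN => [mQ]; apply: le_lt_trans.
  rewrite (ge0_integral_pushforward (sub_sigma_algebra_measurable_id sF FO))//.
    by rewrite RNE.
  exact: measurableT_comp.
split => // A FA; rewrite -intQ//.
under eq_integral do rewrite fineK//.
by rewrite -Radon_Nikodym_integral// measurable_g_measurableTypeE.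
Qed.

(** Existence rules out the default value of [xget]. *)
Lemma cexpP X : P.-integrable setT (EFin \o X) -> is_cexp P F X (cexp P F X).
Proof. by move=> /is_cexp_exists; exact: xgetPex. Qed.

End SubSigmaAlgebra.
End ConditionalExpectation.

(** * Measurability of continuous functionals and time integrals *)

(* Approximation from below on the grid of mesh 1 / (k + 1); the approximants
   take countably many values, which makes their measurability elementary. *)
Section PointwiseApproximation.
Context {d : measure_display} {T : measurableType d} {R : realType}.

(** Preimages split along the countably many level sets of [h]. The functions [phi z] may themselves
    vary with the point, as the joint measurability of a process in time and chance requires. *)
Lemma measurable_fun_countable_family (K : countType) (h : T -> K)
    (phi : K -> T -> R) :
  (forall z, measurable (h @^-1` [set z])) ->
  (forall z, measurable_fun [set: T] (phi z)) ->
  measurable_fun [set: T] (fun w => phi (h w) w).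
Proof.
move=> mh mphi _ C mC; rewrite setTI.
have -> : (fun w => phi (h w) w) @^-1` C =
    \bigcup_(z : K) (h @^-1` [set z] `&` phi z @^-1` C).
  apply/seteqP; split => [w Cw|w [z _ [<-]]]; last by [].
  by exists (h w).
apply: countable_bigcupT_measurable; first exact: countableP.
move=> z; apply: measurableI => //.
by rewrite -[X in measurable X]setTI; exact: mphi.
Qed.

Definition grid_index (k : nat) (x : R) : int := Num.floor (k.+1%:R * x).

Definition grid_point (k : nat) (z : int) : R := z%:~R / k.+1%:R.

Lemma grid_point_le k (x : R) : grid_point k (grid_index k x) <= x.
Proof.
by rewrite /grid_point ler_pdivrMr// mulrC; exact: floor_le.
Qed.

Lemma grid_point_gt k (x : R) :
  x - harmonic k < grid_point k (grid_index k x).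
Proof.
rewrite /grid_point /harmonic ltr_pdivlMr// mulrBl mulVf// ltrBlDr.
have /andP[_] := floor_itv (k.+1%:R * x).
by rewrite /grid_index intrD mulrC.
Qed.

Lemma cvg_grid_point (x : R) :
  grid_point k (grid_index k x) @[k --> \oo] --> x.
Proof.
apply: (@squeeze_cvgr _ _ _ _ (fun k => x - harmonic k) (cst x)).
- by apply: nearW => k; rewrite grid_point_le ltW// grid_point_gt.
- rewrite -[X in _ --> X]subr0; apply: cvgB; first exact: cvg_cst.
  exact: cvg_harmonic.
- exact: cvg_cst.
Qed.

Lemma measurable_grid_index k (z : int) (f : T -> R) :
  measurable_fun [set: T] f ->
  measurable ((fun w => grid_index k (f w)) @^-1` [set z]).
Proof.
move=> mf.
have -> : (fun w => grid_index k (f w)) @^-1` [set z] =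
    (fun w => k.+1%:R * f w) @^-1` `[z%:~R, (z + 1)%:~R[.
  apply/seteqP; split => w /=; rewrite in_itv/= -floor_eq => /eqP //.
rewrite -[X in measurable X]setTI.
exact: (measurable_funM (measurable_cst _) mf).
Qed.

(** Rounding each entry down turns [Y] into a function of an integer matrix, of which there are
    countably many; continuity of [g] passes measurability to the limit. *)
Lemma measurable_continuous_comp_mx p q (g : 'M[R]_(p, q) -> R)
    (Y : T -> 'M[R]_(p, q)) :
  continuous g -> (forall i j, measurable_fun [set: T] (fun w => Y w i j)) ->
  measurable_fun [set: T] (g \o Y).
Proof.
move=> cg mY.
pose h k w : 'M[int]_(p, q) := \matrix_(i, j) grid_index k (Y w i j).
pose pt k (z : 'M[int]_(p, q)) : 'M[R]_(p, q) := map_mx (grid_point k) z.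
apply: (@measurable_fun_cvg _ _ _ _ (fun k w => g (pt k (h k w)))).
  move=> k; apply: (measurable_fun_countable_family (h := h k)
    (phi := fun z _ => g (pt k z))) => z; last exact: measurable_cst.
  have -> : h k @^-1` [set z] =
      \bigcap_(ij : 'I_p * 'I_q)
        ((fun w => grid_index k (Y w ij.1 ij.2)) @^-1` [set z ij.1 ij.2]).
    apply/seteqP; split => [w /= <- [i j] _|w hw]; first by rewrite /= mxE.
    by apply/matrixP => i j; rewrite mxE; exact: (hw (i, j)).
  by apply: fin_bigcap_measurable => // ij _; exact: measurable_grid_index.
move=> w _; apply: cvg_comp (cg (Y w)).
(* A neighbourhood of a matrix contains a product of neighbourhoods of its finitely many entries, so
   entrywise convergence suffices. *)
move=> A [P YP sPA]; rewrite /nbhs/=.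
have : \forall k \near \oo, forall i j,
    P i j (grid_point k (grid_index k (Y w i j))).
  apply: filter_forall => i; apply: filter_forall => j.
  exact: (cvg_grid_point (YP i j)).
apply: filterS => k Pk; apply: sPA => i j; rewrite !mxE; exact: Pk.
Qed.

End PointwiseApproximation.

Section TimeIntegral.
Context {d : measure_display} {T : measurableType d} {R : realType}.

(** Tonelli needs joint measurability in [(w, r)]. It follows from continuity in [r], by evaluating
    [f] at grid times, where it is measurable in [w]. *)
Lemma measurable_Rintegral_itv (s t : R) (f : R -> T -> R) :
  s <= t -> (forall r, s <= r <= t -> measurable_fun [set: T] (f r)) ->
  (forall w, {within `[s, t], continuous (fun r => f r w)}) ->
  measurable_fun [set: T]
    (fun w => \int[lebesgue_measure]_(r in `[s, t]) f r w).
Proof.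
move=> st mf cf.
(* Grid points may leave [[s, t]], outside which nothing is known about [f]; [clamp] projects them
   back and fixes the interval. *)
pose clamp x := Num.max s (Num.min t x).
have clampP x : s <= clamp x <= t.
  by rewrite /clamp le_max lexx/= ge_max st ge_min lexx.
have clamp_id x : s <= x <= t -> clamp x = x.
  by move=> /andP[sx xt]; rewrite /clamp (min_idPr xt) (max_idPr sx).
have cclamp : continuous clamp.
  move=> x; apply: continuous_max; first exact: cst_continuous.
  by apply: continuous_min; [exact: cst_continuous|move=> ?; exact: cvg_id].
pose D : set (T * R) := setT `*` `[s, t].
have mD : measurable D by exact: measurableX.
pose F (p : T * R) : \bar R := ((fun p => (f p.2 p.1)%:E) \_ D) p.
have mF : measurable_fun [set: T * R] F.
  apply/(measurable_restrictT _ mD)/measurable_EFinP.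
  apply: (@measurable_fun_cvg _ _ _ _ (fun k p =>
    f (clamp (grid_point k (grid_index k p.2))) p.1)).
    move=> k; apply: measurable_funTS.
    apply: (measurable_fun_countable_family
      (h := fun p : T * R => grid_index k p.2)
      (phi := fun z p => f (clamp (grid_point k z)) p.1)) => z.
      exact: measurable_grid_index.
    exact: measurableT_comp (mf _ (clampP _)) measurable_fst.
  move=> [w r] [_] /=; rewrite in_itv/= => str.
  have /subspace_continuousP/(_ r) := cf w.
  rewrite /= in_itv/= => /(_ str) cfr.
  apply: (cvg_comp (fun k => clamp (grid_point k (grid_index k r))) (f ^~ w));
    last exact: cfr.
  move=> A; rewrite /within/= /nbhs/= => rA.
  have : clamp (grid_point k (grid_index k r)) @[k --> \oo] --> r.
    rewrite -[X in _ --> X]clamp_id//.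
    apply: (cvg_comp (fun k => grid_point k (grid_index k r)) clamp _
      (cclamp r)).
    exact: (@cvg_grid_point _ (r : R)).
  move=> /(_ _ rA) nearA.
  have {}nearA : \forall k \near \oo,
    `[s, t]%classic (clamp (grid_point k (grid_index k r))) ->
    A (clamp (grid_point k (grid_index k r))) by exact: nearA.
  apply: filterS nearA => k; apply.
  by rewrite /= in_itv/=; exact: clampP.
(* The integral is split into those of the positive and negative parts of the extension by zero, and
   Tonelli applies to each. *)
have -> : (fun w => \int[lebesgue_measure]_(r in `[s, t]) f r w) =
    fine \o (fun w => \int[lebesgue_measure]_r (F^\+ (w, r)) -
                      \int[lebesgue_measure]_r (F^\- (w, r)))%E.
  apply/funext => w; rewrite /Rintegral /=; congr fine.
  rewrite integral_mkcond integralE; congr (_ - _)%E; apply: eq_integral => r _;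
    rewrite ?funeposE ?funenegE /F !patchE;
    by rewrite (_ : ((w, r) \in D) = (r \in `[s, t]%classic))//;
    apply/idP/idP; rewrite !inE => // -[].
apply: measurableT_comp; first exact: fine_measurable.
apply: emeasurable_funB.
- have := @measurable_fun_fubini_tonelli_F _ _ T (measurableTypeR R) R
    lebesgue_measure F^\+%E.
  apply => //; exact: measurable_funepos.
- have := @measurable_fun_fubini_tonelli_F _ _ T (measurableTypeR R) R
    lebesgue_measure F^\-%E.
  apply => //; exact: measurable_funeneg.
Qed.

End TimeIntegral.

(** * Immersion *)

Section Immersion.
Context {dO : measure_display} {Omega : measurableType dO} {R : realType}.
Variables (P : probability Omega R) (T : R) (F G : R -> set (set Omega)).
Hypotheses (hF : filtration T P F) (hG : filtration T P G).

(** Tower property: on an event of [F s] the integrals of [M s] and of [M t] both equal that of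
    [Y]. *)
Lemma closed_martingale (M : R -> Omega -> R) (Y : Omega -> R) :
  (forall u : R, 0 <= u <= T -> is_cexp P (F u) Y (M u)) -> martingale T P F M.
Proof.
have [_ _ Fmono _] := hF.
move=> hM; split => [u /hM[]//|u /hM[]//|s t s0 st tT].
have s0T : 0 <= s <= T by rewrite s0 (le_trans st).
have t0T : 0 <= t <= T by rewrite tT (le_trans s0).
have [mMs iMs Ms] := hM s s0T; have [_ _ Mt] := hM t t0T.
split => // A FA; rewrite Ms// Mt//.
exact: Fmono FA.
Qed.

(** This is the only place where immersion is applied to a martingale; the rest of the argument goes
    through it. *)
Lemma is_cexp_immersed (s t : R) (Y Z : Omega -> R) :
  immersed T P F G -> 0 <= s -> s <= t -> t <= T ->
  (F t `<=` G t) ->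
  measurable_wrt (F t) Y -> P.-integrable setT (EFin \o Y) ->
  is_cexp P (F s) Y Z -> is_cexp P (G s) Y Z.
Proof.
have [Fsig FO Fmono _] := hF; have [Gsig GO _ _] := hG.
move=> himm s0 st tT FGt mY iY ZY.
have t0T : 0 <= t <= T by rewrite tT (le_trans s0).
have Yself u : t <= u -> u <= T -> is_cexp P (F u) Y Y.
  move=> tu uT; split => // C mC.
  by apply: (Fmono t u _ tu uT); [case/andP: t0T|exact: mY].
have [lt_st|ge_st] := ltP s t.
  (* At time [s] the given version [Z] replaces the chosen one, so that the [G]-martingale property
     at the pair [(s, t)] is literally the claim. *)
  pose M u := if u == s then Z else if u < t then cexp P (F u) Y else Y.
  have /himm[_ _ /(_ s t s0 st tT)] : martingale T P F M.
    apply: (@closed_martingale _ Y) => u uT; rewrite /M.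
    case: eqVneq => [->//|_]; case: ltP => [ut|tu].
      by apply: cexpP => //; [exact: Fsig|exact: FO].
    by apply: Yself => //; case/andP: uT.
  by rewrite /M eqxx gt_eqF// ltxx.
(* For [s = t] no martingale can carry both [Z] and [Y] at that time. Here [Y] is its own
   conditional expectation, so [Z] equals [Y] almost surely by uniqueness. *)
have ts : t = s by apply/eqP; rewrite eq_le ge_st st.
rewrite -ts in ZY *.
have [mZ iZ _] := ZY.
split => // [C mC|A GA]; first exact/FGt/mZ.
have FOt := FO _ t0T; have GOt := GO _ t0T.
have /is_cexp_ae_eq/(_ ZY) YZ := Yself t (lexx t) tT.
apply: ae_eq_integral.
- exact: GOt.
- by apply/measurable_EFinP/measurable_funTS;
    exact: sub_sigma_measurable_wrt mZ.
- by apply/measurable_EFinP/measurable_funTS;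
    exact: sub_sigma_measurable_wrt mY.
- by apply: filterS (YZ (Fsig _ t0T) FOt) => w /= + _ => ->.
Qed.

Lemma cexp_immersed (s t : R) (Y : Omega -> R) :
  immersed T P F G -> 0 <= s -> s <= t -> t <= T ->
  (F t `<=` G t) ->
  measurable_wrt (F t) Y -> P.-integrable setT (EFin \o Y) ->
  ae_eq P setT (cexp P (F s) Y) (cexp P (G s) Y).
Proof.
have [Fsig FO _ _] := hF; have [Gsig GO _ _] := hG.
move=> himm s0 st tT FGt mY iY.
have s0T : 0 <= s <= T by rewrite s0 (le_trans st).
apply: (is_cexp_ae_eq (Gsig _ s0T) (GO _ s0T) (X := Y)).
  apply: (is_cexp_immersed himm s0 st) => //.
  by apply: cexpP => //; [exact: Fsig|exact: FO].
by apply: cexpP => //; [exact: Gsig|exact: GO].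
Qed.

Lemma brownian_motion_immersed (d : nat) (B : R -> Omega -> 'cV[R]_d) :
  immersed T P F G -> (forall t : R, 0 <= t <= T -> F t `<=` G t) ->
  brownian_motion T P F B -> brownian_motion T P G B.
Proof.
move=> himm FG [B0 cB aB incB].
have [Fsig FO Fmono _] := hF; have [Gsig GO _ _] := hG.
split => // [t tT i j C mC|s t s0 st tT]; first exact/FG/aB.
have [indep law] := incB s t s0 st tT; split => // A C GA mC E.
have s0T : 0 <= s <= T by rewrite s0 ltW// (lt_le_trans st).
have t0T : 0 <= t <= T by rewrite tT (le_trans s0 (ltW st)).
(* Both [B s] and [B t] are [F t]-measurable, which makes the indicator of [E] eligible for the
   immersion lemma. *)
have FE : F t E.
  have : measurable_fun [set: g_sigma_algebraType (F t)]
      (fun w => [tuple B t w j 0 - B s w j 0 | j < d]).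
    apply/measurable_fun_tnthP => j; rewrite /comp/=.
    under eq_fun do rewrite tnth_mktuple.
    apply: measurable_funB; apply/(measurable_wrtP _ (Fsig _ t0T)) => D mD.
      exact: aB.
    by apply: (Fmono s t s0 (ltW st) tT); exact: aB.
  move=> /(_ measurableT C mC).
  by rewrite setTI measurable_g_measurableTypeE//; exact: Fsig.
have mE : measurable E := FO _ t0T _ FE.
have int1E D : measurable D -> (\int[P]_(w in D) (\1_E w)%:E = P (D `&` E))%E.
  by move=> mD; rewrite integral_indic// setIC.
have intcE D : measurable D ->
    (\int[P]_(w in D) (cst (fine (P E)) w)%:E = P D * P E)%E.
  move=> mD; rewrite (@integral_cst _ _ _ P D mD (fine (P E))%:E).
  by rewrite fineK ?fin_num_measure// muleC.
(* Independence of [E] from [F s] says that the constant [P E] is a version of the conditional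
   expectation of the indicator given [F s]. Moved to [G s] and tested on [A], this is the product
   formula. *)
have : is_cexp P (G s) \1_E (cst (fine (P E))).
  apply: (@is_cexp_immersed s t) => //; first exact: ltW.
  - exact: FG.
  - apply/(measurable_wrtP _ (Fsig _ t0T)); apply: measurable_indic.
    by rewrite measurable_g_measurableTypeE//; exact: Fsig.
  - exact: integrable_indic.
  - split.
    + by apply/(measurable_wrtP _ (Fsig _ s0T)); exact: measurable_cst.
    + exact: finite_measure_integrable_cst.
    + move=> D FD; have mD := FO _ s0T _ FD.
      by rewrite int1E// intcE// indep.
move=> [_ _ /(_ A GA)]; have mA := GO _ s0T _ GA.
by rewrite int1E// intcE.
Qed.

End Immersion.

(** * The remainder and its norms *)

(** The exponent is left general in order to cover the outer norms for [m] and for [+oo]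
    together. *)
Lemma ae_eq_Lnorm d (T : measurableType d) (R : realType)
    (mu : {measure set T -> \bar R}) (q : \bar R) (f g : T -> \bar R) :
  measurable_fun setT f -> measurable_fun setT g -> ae_eq mu setT f g ->
  Lnorm mu q f = Lnorm mu q g.
Proof.
move=> mf mg fg; rewrite unlock; case: q => [r||].
- congr poweR; apply: ae_eq_integral => //.
  + by apply: (measurableT_comp (measurable_poweR _)); exact: measurableT_comp.
  + by apply: (measurableT_comp (measurable_poweR _)); exact: measurableT_comp.
  + by apply: filterS fg => x /= fgx xT; rewrite fgx.
- case: ifP => // _; apply: eq_ess_sup.
  by apply: filterS fg => x /= fgx; rewrite fgx.
- case: ifP => // _; apply: eq_ess_inf.
  by apply: filterS fg => x /= fgx; rewrite fgx.
Qed.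

Lemma measurable_enorm d (T : measurableType d) (R : realType) p q
    (Y : T -> 'M[R]_(p, q)) :
  (forall i j, measurable_fun setT (fun w => Y w i j)) ->
  measurable_fun setT (fun w => enorm (Y w)).
Proof.
move=> mY; apply: measurableT_comp.
  exact: (continuous_measurable_fun (@sqrt_continuous R)).
apply: measurable_sum => i; apply: measurable_sum => j.
exact: measurable_funX.
Qed.

Lemma enorm_ge0 (R : realType) p q (A : 'M[R]_(p, q)) : 0 <= enorm A.
Proof. exact: sqrtr_ge0. Qed.

Lemma enorm_le_sum (R : realType) n (x : 'cV[R]_n) :
  enorm x <= \sum_i `|x i 0|.
Proof.
rewrite /enorm -[leRHS]ger0_norm ?sumr_ge0// -sqrtr_sqr ler_sqrt ?sqr_ge0//.
under eq_bigr do rewrite big_ord1.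
(* Nonnegativity of the partial sums is carried through the induction, since it gives the cross term
   of the square its sign. *)
suff /andP[] : (0 <= \sum_i `|x i 0|) &&
    (\sum_i x i 0 ^+ 2 <= (\sum_i `|x i 0|) ^+ 2) by [].
elim/big_ind2 : _ => [|a b a' b' /andP[b0 ab] /andP[b'0 ab']|i _].
- by rewrite expr0n lexx.
- by rewrite addr_ge0//=; nra.
- by rewrite normr_ge0 real_normK ?num_real/=.
Qed.

(** Membership in [L_m] is given entry by entry. By Minkowski the sum of the absolute entries is in
    [L_m], and it dominates the Euclidean norm. *)
Lemma integrable_enorm_powR d (T : measurableType d) (R : realType)
    (mu : {measure set T -> \bar R}) n (m : R) (Y : T -> 'cV[R]_n) :
  1 <= m -> (forall i, (fun w => Y w i 0) \in Lfun mu m%:E) ->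
  mu.-integrable setT (fun w => (enorm (Y w) `^ m)%:E).
Proof.
move=> m1 LY.
have mY i : measurable_fun setT (fun w => Y w i 0).
  by have := sub_Lfun_mfun (LY i); rewrite inE.
have [L0 LD] := Lfun_addr_closed mu (m1 : (1%:E <= m%:E)%E).
have Lnorm_i i : (fun w => `|Y w i 0|) \in Lfun mu m%:E.
  move: (LY i); rewrite !inE => /andP[_]; rewrite !inE/= => fY.
  apply/andP; split; rewrite inE/=; first exact: measurableT_comp.
  by rewrite /finite_norm -(Lnorm_abse _ (EFin \o fun w => Y w i 0)) in fY *.
have : (\sum_i (fun w => `|Y w i 0|)) \in Lfun mu m%:E.
  by elim/big_ind : _ => //.
move=> /(Lfun_integrable m1); apply: le_integrable => //.
  apply/measurable_EFinP; apply: (measurableT_comp (measurable_powR _)).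
  by apply: measurable_enorm => i j; rewrite ord1.
move=> w _; rewrite !gee0_abs ?lee_fin ?powR_ge0//.
rewrite ge0_ler_powR ?nnegrE ?enorm_ge0 ?(le_trans _ m1)//.
by rewrite fct_sumE (le_trans (enorm_le_sum _))// ler_norm.
Qed.

(** * Continuity of the coefficients and measurability of the remainder *)

Section Slices.
Context {R : realType} {n : nat} {V : topologicalType}.
Variables (T : R) (g : R -> 'cV[R]_n -> V).
Hypothesis cg : jointly_continuous T g.

Lemma jointly_continuousP (r : R) x (A : set V) : 0 <= r <= T ->
  nbhs (g r x) A ->
  \forall p \near (r, x), 0 <= p.1 <= T -> A (g p.1 p.2).
Proof.
move=> rT gA; exact: ((subspace_continuousP _ _).1 cg (r, x) rT A gA).
Qed.

Lemma jointly_continuous_slice (r : R) : 0 <= r <= T -> continuous (g r).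
Proof.
move=> rT x A /(jointly_continuousP rT) gA.
have /(_ _ gA) : (r, y) @[y --> x] --> (r, x).
  by apply: (@cvg_pair _ _ _ (nbhs x) (nbhs r) (nbhs x)); [exact: cvg_cst|].
move=> {}gA.
have {}gA : \forall y \near x, 0 <= r <= T -> A (g r y) by exact: gA.
by apply: filterS gA => y; exact.
Qed.

(** The map [r |-> (r, x r)] is continuous on [[0, T]] and stays in the strip where [g] is
    continuous. *)
Lemma jointly_continuous_path (x : R -> 'cV[R]_n) :
  {within `[0, T], continuous x} ->
  {within `[0, T], continuous (fun r => g r (x r))}.
Proof.
move=> /subspace_continuousP cx; apply/subspace_continuousP => r.
rewrite /= in_itv/= => rT A /(jointly_continuousP rT) gA.
have /(_ _ gA) : (u, x u) @[u --> within `[0, T] (nbhs r)] --> (r, x r).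
  apply: (@cvg_pair _ _ _ _ (nbhs r) (nbhs (x r))); first exact: cvg_within.
  by apply: cx; rewrite /= in_itv.
move=> {}gA; have {}gA : \forall u \near r, u \in `[0, T] ->
    0 <= u <= T -> A (g u (x u)) by exact: gA.
suff : \forall u \near r, u \in `[0, T] -> A (g u (x u)) by [].
by apply: filterS gA => u + uT; apply => //; move: uT; rewrite in_itv.
Qed.

End Slices.

Section RemainderMeasurable.
Context {R : realType} {dO : measure_display} {Omega : measurableType dO}.
Context {n d e : nat}.
Variables (P : probability Omega R) (T : R) (S : rough_sde R n d e).
Variable F : R -> set (set Omega).
Hypotheses (hF : filtration T P F) (hS : continuous_coefficients T S).

Lemma adapted_continuous_comp (X : R -> Omega -> 'cV[R]_n)
    (g : 'cV[R]_n -> 'cV[R]_n) (r t : R) (i : 'I_n) :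
  adapted T F X -> continuous g -> 0 <= r -> r <= t -> t <= T ->
  measurable_fun [set: g_sigma_algebraType (F t)] (fun w => g (X r w) i 0).
Proof.
have [Fsig _ Fmono _] := hF.
move=> aX cg r0 rt tT.
apply: (@measurable_continuous_comp_mx _ _ _ _ _ (fun x => g x i 0)).
  move=> x; apply: (cvg_comp g (fun y : 'cV[R]_n => y i 0) (cg x)).
  exact: coord_continuous.
move=> k l; apply/measurable_wrtP => [|C mC]; first by apply: Fsig; lra.
by apply: (Fmono r t r0 rt tT); apply: aX => //; lra.
Qed.

(** Every term evaluates [X] and [I] at times in [[s, t]] only, and all these values are
    [F t]-measurable. *)
Lemma remainder_measurable (X I : R -> Omega -> 'cV[R]_n) (s t : R) :
  continuous_paths T X -> adapted T F X -> adapted T F I ->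
  0 <= s -> s <= t -> t <= T ->
  mx_measurable_wrt (F t) (remainder S X I s t).
Proof.
have [Fsig FO Fmono _] := hF; have [cb _ cf cD] := hS.
move=> cX aX aI s0 st tT i j; rewrite ord1.
have s0T : 0 <= s <= T by lra.
have t0T : 0 <= t <= T by lra.
apply/measurable_wrtP; first exact: Fsig.
pose mF := measurable_fun [set: g_sigma_algebraType (F t)].
have mA (Y : R -> Omega -> 'cV[R]_n) r : adapted T F Y -> 0 <= r -> r <= t ->
    mF _ _ (fun w => Y r w i 0).
  move=> aY r0 rt; apply: (@adapted_continuous_comp Y id) => // x.
  exact: cvg_id.
have mdrift : mF _ _ (fun w =>
    \int[lebesgue_measure]_(r in `[s, t]) drift S r (X r w) i 0).
  apply: measurable_Rintegral_itv => // [r rst|w].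
    apply: adapted_continuous_comp => //; try lra.
    by apply: (jointly_continuous_slice cb); lra.
  have cdX : {within `[0, T], continuous (fun r => drift S r (X r w))}.
    exact: jointly_continuous_path.
  apply: continuous_subspaceW (_ : {within `[0, T], continuous _}).
    by apply: subset_itvScc; rewrite bnd_simp.
  apply: (within_continuous_comp
    _ _ (fun x : 'cV[R]_n => x i 0) _ cdX).
  by move=> x _; exact: coord_continuous.
have mvf k : mF _ _ (fun w => vf S s k (X s w) i 0).
  apply: adapted_continuous_comp => //.
  exact: (jointly_continuous_slice (cf k)).
(* The standing continuity concerns [Df f + f'] as a whole, so its two summands are kept
   together. *)
have mDff k l : mF _ _ (fun w => Dff S s k l (X s w) i 0).
  apply: adapted_continuous_comp => //.
  exact: (jointly_continuous_slice (cD k l)).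
have -> : (fun w => remainder S X I s t w i 0) = (fun w =>
    X t w i 0 - X s w i 0
    - \int[lebesgue_measure]_(r in `[s, t]) drift S r (X r w) i 0
    - (I t w i 0 - I s w i 0)
    - \sum_k incr (rZ S) s t k 0 * vf S s k (X s w) i 0
    - \sum_k \sum_l rZZ S s t k l * Dff S s k l (X s w) i 0).
  apply/funext => w; rewrite /remainder !mxE !summxE.
  congr (_ - _ - _).
    by apply: eq_bigr => k _; rewrite !mxE.
  apply: eq_bigr => k _; rewrite summxE.
  by apply: eq_bigr => l _; rewrite !mxE.
apply: measurable_funB.
  apply: measurable_funB.
    apply: measurable_funB; last first.
      by apply: measurable_funB; apply: mA => //; lra.
    by apply: measurable_funB => //; apply: measurable_funB;
      apply: mA => //; lra.
  apply: measurable_sum => k.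
  exact: measurable_funM (measurable_cst _) (mvf k).
apply: measurable_sum => k; apply: measurable_sum => l.
exact: measurable_funM (measurable_cst _) (mDff k l).
Qed.

End RemainderMeasurable.

(** * Conditional norms under immersion *)

Section ConditionalNorms.
Context {R : realType} {dO : measure_display} {Omega : measurableType dO}.
Context {n : nat}.
Variables (P : probability Omega R) (T : R) (F G : R -> set (set Omega)).
Hypotheses (hF : filtration T P F) (hG : filtration T P G).
Hypothesis hFG : forall t : R, 0 <= t <= T -> F t `<=` G t.
Hypothesis himm : immersed T P F G.
Variables (J : R -> R -> Omega -> 'cV[R]_n) (m : R).
Hypotheses (m1 : 1 <= m) (hJ : in_Lm T P m J).
Hypothesis mJ : forall s t : R, 0 <= s -> s <= t -> t <= T ->
  mx_measurable_wrt (F t) (J s t).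

Let measurable_cexp (H : R -> set (set Omega)) (s : R) (Y : Omega -> R) :
  filtration T P H -> 0 <= s <= T -> P.-integrable setT (EFin \o Y) ->
  measurable_fun setT (cexp P (H s) Y).
Proof.
move=> [Hsig HO _ _] sT /(cexpP (Hsig s sT) (HO s sT))[mY _ _].
exact: sub_sigma_measurable_wrt (HO s sT) mY.
Qed.

Lemma cond_bias_immersed (q : \bar R) (s t : R) :
  0 <= s -> s <= t -> t <= T -> cond_bias P F q J s t = cond_bias P G q J s t.
Proof.
move=> s0 st tT.
have sT : 0 <= s <= T by lra.
have tT' : 0 <= t <= T by lra.
(* On a probability space [L_m] is contained in [L_1]. *)
have iJ i : P.-integrable setT (EFin \o (fun w => J s t w i 0)).
  apply/Lfun1_integrable.
  apply: (@Lfun_subset _ _ _ P 1%E m%:E _ _ _ _ _ (hJ s0 st tT i)) => //.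
  exact: fin_num_measure.
have mbias (H : R -> set (set Omega)) : filtration T P H ->
    measurable_fun setT (fun w => (enorm (mx_cexp P (H s) (J s t) w))%:E).
  move=> hH; apply/measurable_EFinP/measurable_enorm => i j.
  under eq_fun do rewrite mxE ord1.
  exact: measurable_cexp.
apply: ae_eq_Lnorm; [exact: mbias|exact: mbias|].
(* The null sets of the finitely many coordinates are united into one. *)
have : \forall w \ae P, forall i, cexp P (F s) (fun w => J s t w i 0) w =
    cexp P (G s) (fun w => J s t w i 0) w.
  apply: filter_forall => i.
  have := cexp_immersed hF hG himm s0 st tT (hFG tT') (mJ s0 st tT i 0) (iJ i).
  by apply: filterS => w; apply.
apply: filterS => w FG _; congr ((enorm _)%:E).
by apply/matrixP => i j; rewrite !mxE ord1 FG.
Qed.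

Lemma cond_size_immersed (q : \bar R) (s t : R) :
  0 <= s -> s <= t -> t <= T ->
  cond_size P F m q J s t = cond_size P G m q J s t.
Proof.
move=> s0 st tT; have [Fsig FO _ _] := hF.
have sT : 0 <= s <= T by lra.
have tT' : 0 <= t <= T by lra.
have iJ : P.-integrable setT (EFin \o (fun w => enorm (J s t w) `^ m)).
  exact: integrable_enorm_powR (hJ s0 st tT).
have mwJ : measurable_wrt (F t) (fun w => enorm (J s t w) `^ m).
  apply/(measurable_wrtP _ (Fsig _ tT')).
  apply: (measurableT_comp (measurable_powR _)).
  apply: measurable_enorm => i j; apply/(measurable_wrtP _ (Fsig _ tT')).
  exact: mJ.
have msize (H : R -> set (set Omega)) : filtration T P H ->
    measurable_fun setT (fun w =>
      ((cexp P (H s) (fun w' => enorm (J s t w') `^ m) w) `^ m^-1)%:E).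
  move=> hH; apply/measurable_EFinP.
  by apply: (measurableT_comp (measurable_powR _)); exact: measurable_cexp.
apply: ae_eq_Lnorm; [exact: msize|exact: msize|].
have := cexp_immersed hF hG himm s0 st tT (hFG tT') mwJ iJ.
by apply: filterS => w /= /[apply] ->.
Qed.

End ConditionalNorms.

(** * Passage of the solution notion to the larger filtration *)

Section ItoIntegral.
Context {R : realType} {dO : measure_display} {Omega : measurableType dO}.
Variables (P : probability Omega R) (T : R) (F G : R -> set (set Omega)).
Hypothesis hFG : forall t : R, 0 <= t <= T -> F t `<=` G t.

Lemma sub_adapted p q (X : R -> Omega -> 'M[R]_(p, q)) :
  adapted T F X -> adapted T G X.
Proof. by move=> aX t tT i j C mC; apply: hFG => //; exact: aX. Qed.

(** Same approximating processes and same limits in probability: the filtration enters only through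
    measurability, which an enlargement preserves. *)
Lemma sub_ito_integral n d (B : R -> Omega -> 'cV[R]_d)
    (H : R -> Omega -> 'M[R]_(n, d)) I :
  ito_integral T P F B H I -> ito_integral T P G B H I.
Proof.
move=> [cI /sub_adapted aI [Hk [aHk HkH HkI]]]; split => //.
exists Hk; split => // k; have [tT tS mH bH] := aHk k; split => //.
by move=> l lk i j C mC; apply/hFG/mH => //; apply/tT/ltnW.
Qed.

Lemma sub_state_process n (D : set 'cV[R]_n) X :
  state_process T D F X -> state_process T D G X.
Proof. by move=> [cX /sub_adapted aX XD]. Qed.

End ItoIntegral.

Section ImmersedSolution.
Context {R : realType} {dO : measure_display} {Omega : measurableType dO}.
Context {n d e : nat}.
Variables (P : probability Omega R) (T : R) (F G : R -> set (set Omega)).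
Variables (D : set 'cV[R]_n) (S : rough_sde R n d e).
Variables (B : R -> Omega -> 'cV[R]_d) (m : R) (q : \bar R).
Hypotheses (hF : filtration T P F) (hG : filtration T P G).
Hypothesis hFG : forall t : R, 0 <= t <= T -> F t `<=` G t.
Hypothesis himm : immersed T P F G.
Hypotheses (hS : continuous_coefficients T S) (m1 : 1 <= m).

(** The same process [I] serves as Ito integral, so the remainder is unchanged and its conditional
    norms coincide at every pair of times. *)
Lemma solution_immersed X :
  solution T P D S F B m q X -> solution T P D S G B m q X.
Proof.
move=> [hX [I [hI hJ bias size]]]; have [cX aX _] := hX; have [_ aI _] := hI.
have mJ := remainder_measurable hF hS cX aX aI.
split; first exact: sub_state_process hX.
exists I; split => //; first exact: sub_ito_integral hI.
- move=> eps /bias[delta delta0 h]; exists delta => // s t s0 st tT tsd.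
  by rewrite -(cond_bias_immersed hF hG hFG himm m1 hJ mJ)//; exact: h.
- move=> eps /size[delta delta0 h]; exists delta => // s t s0 st tT tsd.
  by rewrite -(cond_size_immersed hF hG hFG himm m1 hJ mJ)//; exact: h.
Qed.

Lemma solution_with_moduli_immersed omega omega' X :
  solution_with_moduli T P D S F B m q omega omega' X ->
  solution_with_moduli T P D S G B m q omega omega' X.
Proof.
move=> [hX om om' [I [hI hJ bias size]]].
have [cX aX _] := hX; have [_ aI _] := hI.
have mJ := remainder_measurable hF hS cX aX aI.
split => //; first exact: sub_state_process hX.
exists I; split => //; first exact: sub_ito_integral hI.
- move=> s t s0 st tT.
  by rewrite -(cond_bias_immersed hF hG hFG himm m1 hJ mJ)//; exact: bias.
- move=> s t s0 st tT.
  by rewrite -(cond_size_immersed hF hG hFG himm m1 hJ mJ)//; exact: size.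
Qed.

End ImmersedSolution.

Theorem lemma5p3 (R : realType) (dO : measure_display)
  (Omega : measurableType dO) (P : probability Omega R)
  (T gamma m : R) (n d e : nat) (D : set 'cV[R]_n) (S : rough_sde R n d e)
  (F G : R -> set (set Omega)) (B : R -> Omega -> 'cV[R]_d)
  (X : R -> Omega -> 'cV[R]_n)
  (hT : 0 < T) (hn : (0 < n)%N) (hd : (0 < d)%N) (he : (0 < e)%N)
  (hgamma : 3^-1 < gamma < 2^-1) (hm : 2 <= m) (hD : closed D)
  (hS : standing_assumptions T gamma S)
  (hF : filtration T P F) (hG : filtration T P G)
  (hFG : forall t : R, 0 <= t <= T -> F t `<=` G t)
  (himm : immersed T P F G)
  (hB : brownian_motion T P F B) :
  brownian_motion T P G B /\
  (Lm_solution T P D S F B m X ->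
     Lm_solution T P D S G B m X /\
     (forall omega omega' : R -> \bar R,
        Lm_solution_with_moduli T P D S F B m omega omega' X ->
        Lm_solution_with_moduli T P D S G B m omega omega' X)) /\
  (Lmoo_solution T P D S F B m X ->
     Lmoo_solution T P D S G B m X /\
     (forall omega omega' : R -> \bar R,
        Lmoo_solution_with_moduli T P D S F B m omega omega' X ->
        Lmoo_solution_with_moduli T P D S G B m omega omega' X)).
Proof.
have [_ _ _ cS] := hS.
have m1 : 1 <= m by lra.
split; first exact: (brownian_motion_immersed hF hG himm hFG).
(* The two solution notions are the cases [q = m] and [q = +oo] of the transfer lemmas. *)
by split => sol; (split; first exact: solution_immersed sol);
  move=> omega omega'; exact: solution_with_moduli_immersed.
Qed.
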